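(* Let $\mathcal{A}\in\mathbb{R}^{n_1\times\dots\times n_d}$ be a tensor, let $\epsilon>0$ and, for $k=1,\dots,d$, let $X_k\in\mathbb{R}^{\left(\prod_{j\ne k}n_j\right)\times r_k}$ and $Y_k\in\mathbb{R}^{n_k\times(r_k+\ell_k)}$. Let $\widetilde{\mathcal{P}}_k:=\mathcal{A}_kX_k(Y_k^T\widetilde{\mathcal{A}}_kX_k)_\epsilon^\dagger Y_k^T$, where $\widetilde{\mathcal{A}}_k=\mathcal{A}_k+\delta\mathcal{A}_k$ with $\delta\mathcal{A}_k$ a perturbation matrix of the same size as $\mathcal{A}_k$, and set $$\widetilde\varepsilon_k:=\|\mathcal{A}-\mathcal{A}\times_k\widetilde{\mathcal{P}}_k\|_F\quad\text{and}\quad\widetilde\tau_k:=1+\|\widetilde{\mathcal{P}}_k\|_2 .$$ Then, denoting $\widetilde\varepsilon:=\max_k\widetilde\varepsilon_k$ and $\widetilde\tau:=\max_k\widetilde\tau_k$, we have $$\|\mathcal{A}-\mathcal{A}\times_{k=1}^d\widetilde{\mathcal{P}}_k\|_F\le\frac{\widetilde\varepsilon}{\widetilde\tau}\big((1+\widetilde\tau)^d-1\big).$$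
   Context: For a tensor $\mathcal{A}\in\mathbb{R}^{n_1\times\dots\times n_d}$, $\mathcal{A}_k\in\mathbb{R}^{n_k\times\prod_{j\ne k}n_j}$ denotes its mode-$k$ matricization: $(\mathcal{A}_k)_{i_k,j}=\mathcal{A}_{i_1,\dots,i_d}$ with $j=1+\sum_{t\neq k}(i_t-1)J_t$, $J_t=\prod_{s<t,\,s\ne k}n_s$. The mode-$k$ product of $\mathcal{A}$ with $M\in\mathbb{R}^{J\times n_k}$ is the tensor $\mathcal{A}\times_kM$ with entries $(\mathcal{A}\times_kM)_{i_1\dots i_{k-1}\,j\,i_{k+1}\dots i_d}=\sum_{s=1}^{n_k}\mathcal{A}_{i_1\dots i_{k-1}\,s\,i_{k+1}\dots i_d}M_{js}$, and $\mathcal{A}\times_{k=1}^dM_k=\mathcal{A}\times_1M_1\times_2\dots\times_dM_d$. $\|\cdot\|_F$ is the Frobenius norm and $\|\cdot\|_2$ the spectral norm. For a matrix $M$ with SVD $M=[U_1\ U_2]\,\mathrm{diag}(\Sigma_1,\Sigma_2)\,[V_1\ V_2]^T$, where $\Sigma_1$ contains the singular values larger than $\epsilon$, the $\epsilon$-pseudoinverse is $M_\epsilon^\dagger:=V_1\Sigma_1^{-1}U_1^T$ (singular values not larger than $\epsilon$ are treated as zero). The $\ell_k\ge0$ are integers. *)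

(* Defs.v *)
From HB Require Import structures.
From mathcomp Require Import all_boot all_order all_algebra.
From mathcomp Require Import all_classical all_reals all_analysis.
From mathcomp Require Import ring lra zify.

Set Implicit Arguments.
Unset Strict Implicit.
Unset Printing Implicit Defensive.

Import Order.TTheory GRing.Theory Num.Theory.
Import numFieldNormedType.Exports.

Local Open Scope classical_set_scope.
Local Open Scope ring_scope.

Notation tindex n := {dffun forall k, 'I_(n k)}.
Notation tensor R n := {ffun tindex n -> R}.

Definition tfrob (R : realType) (d : nat) (n : 'I_d -> nat)
  (A : tensor R n) : R := Num.sqrt (\sum_i A i ^+ 2).

(* Only square matrices are needed, so the shape of the tensor is unchanged. *)
Definition modeprod (R : realType) (d : nat) (n : 'I_d -> nat)
    (A : tensor R n) (k : 'I_d) (M : 'M[R]_(n k)) : tensor R n :=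
  [ffun i : tindex n =>
    \sum_(s < n k) A (finfun (eqtype.dfwith i s)) * M (i k) s].

Definition multiprod (R : realType) (d : nat) (n : 'I_d -> nat)
    (A : tensor R n) (M : forall k, 'M[R]_(n k)) : tensor R n :=
  foldl (fun B k => modeprod B (M k)) A (enum 'I_d).

(* Zero-based version of j = 1 + \sum_(t != k) (i_t - 1) J_t. *)
Definition matcol_nat (d : nat) (n : 'I_d -> nat) (k : 'I_d)
    (i : tindex n) : nat :=
  (\sum_(t < d | t != k) i t * \prod_(s < d | (s < t) && (s != k)) n s)%N.

Section MixedRadix.

Local Open Scope nat_scope.

Let radix d (n a : 'I_d -> nat) (P : pred 'I_d) :=
  \sum_(t < d | P t) a t * \prod_(s < d | (s < t) && P s) n s.

Let radixS d (n a : 'I_d.+1 -> nat) (P : pred 'I_d.+1)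
    (w := widen_ord (leqnSn d)) :
  radix n a P = radix (n \o w) (a \o w) (P \o w) +
    (if P ord_max then a ord_max * \prod_(t < d | P (w t)) n (w t) else 0).
Proof.
rewrite /radix big_mkcond big_ord_recr /= -big_mkcond; congr addn.
  apply: eq_bigr => t _; congr muln.
  by rewrite big_mkcond big_ord_recr /= ltnNge ltnW//= muln1 -big_mkcond.
case: ifP => // _; congr muln.
rewrite big_mkcond big_ord_recr /= ltnn muln1 -big_mkcond.
by apply: eq_bigl => s; rewrite ltn_ord.
Qed.

Let prodS d (n : 'I_d.+1 -> nat) (P : pred 'I_d.+1)
    (w := widen_ord (leqnSn d)) :
  \prod_(t < d.+1 | P t) n t =
  \prod_(t < d | P (w t)) n (w t) * (if P ord_max then n ord_max else 1).
Proof. by rewrite big_mkcond big_ord_recr -big_mkcond. Qed.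

Lemma mixed_radix_lt d (n a : 'I_d -> nat) (P : pred 'I_d) :
  (forall t, P t -> a t < n t) ->
  \sum_(t < d | P t) a t * \prod_(s < d | (s < t) && P s) n s
    < \prod_(t < d | P t) n t.
Proof.
elim: d n a P => [|d IH] n a P an; first by rewrite !big_ord0.
rewrite -/(radix n a P) radixS prodS.
have := IH (n \o _) (a \o _) (P \o _) (fun t => an (widen_ord (leqnSn d) t)).
rewrite -/(radix _ _ _) /=; case: ifP => [/an|_]; last by rewrite addn0 muln1.
by nia.
Qed.

Lemma mixed_radix_inj d (n a b : 'I_d -> nat) (P : pred 'I_d) :
  (forall t, P t -> a t < n t) -> (forall t, P t -> b t < n t) ->
  \sum_(t < d | P t) a t * \prod_(s < d | (s < t) && P s) n s
    = \sum_(t < d | P t) b t * \prod_(s < d | (s < t) && P s) n s ->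
  forall t, P t -> a t = b t.
Proof.
elim: d n a b P => [|d IH] n a b P an bn; first by move=> _ [].
rewrite -/(radix n a P) -/(radix n b P) !radixS.
set w := widen_ord _.
have /= := @mixed_radix_lt d (n \o w) (a \o w) (P \o w) (fun t => an (w t)).
have /= := @mixed_radix_lt d (n \o w) (b \o w) (P \o w) (fun t => bn (w t)).
have /= := IH (n \o w) (a \o w) (b \o w) (P \o w) (fun t => an (w t))
  (fun t => bn (w t)).
rewrite -/(radix (n \o w) (a \o w) _) -/(radix (n \o w) (b \o w) _).
set ra := radix _ _ _; set rb := radix _ _ _; set p := \prod_(_ < _ | _) _.
move=> {}IH rbp rap E.
have [rab mab] : ra = rb /\ (P ord_max -> a ord_max = b ord_max).
  case: ifP E => [_ E|_]; last by rewrite !addn0.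
  have ab : a ord_max = b ord_max.
    have p0 : 0 < p by exact: leq_ltn_trans rap.
    have := congr1 (divn^~ p) E; rewrite /= ![_ + _ * p]addnC.
    by rewrite !divnMDl// !divn_small// !addn0.
  by split=> //; move: E; rewrite ab => /addIn.
move=> t; case: (unliftP ord_max t) => [s ->|-> //].
have -> : lift ord_max s = w s by apply/val_inj; exact: lift_max.
exact: IH.
Qed.

End MixedRadix.

Lemma matcol_lt d (n : 'I_d -> nat) k (i : tindex n) :
  (matcol_nat k i < \prod_(j < d | j != k) n j)%N.
Proof. exact: mixed_radix_lt. Qed.

Definition matcol (d : nat) (n : 'I_d -> nat) (k : 'I_d) (i : tindex n) :
  'I_(\prod_(j < d | j != k) n j) := Ordinal (matcol_lt k i).

(* The sum has exactly one term, see matricizationE. *)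
Definition matricization (R : realType) (d : nat) (n : 'I_d -> nat)
    (A : tensor R n) (k : 'I_d) : 'M[R]_(n k, \prod_(j < d | j != k) n j) :=
  \matrix_(a, b) \sum_(i : tindex n | (i k == a) && (matcol k i == b)) A i.

Lemma matricizationE (R : realType) d (n : 'I_d -> nat) (A : tensor R n) k
  (i : tindex n) : matricization A k (i k) (matcol k i) = A i.
Proof.
rewrite mxE (big_pred1 i)// => j /=; apply/andP/eqP => [[/eqP jk /eqP]|->//].
move=> /(congr1 val) /= jE; apply/ffunP => t.
have [->//|tk] := eqVneq t k.
by apply/val_inj; apply: (mixed_radix_inj _ _ jE) => // u _.
Qed.

Definition frob (R : realType) (m n : nat) (A : 'M[R]_(m, n)) : R :=
  Num.sqrt (\sum_i \sum_j A i j ^+ 2).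

(* The operator norm induced by the Euclidean norm, which is frob on columns. *)
Definition spectral_norm (R : realType) (m n : nat) (A : 'M[R]_(m, n)) : R :=
  sup [set frob (A *m x) | x in [set x : 'cV[R]_n | frob x <= 1]].

Definition is_svd (R : realType) (m n : nat) (M : 'M[R]_(m, n))
    (U : 'M[R]_m) (S : 'M[R]_(m, n)) (V : 'M[R]_n) : Prop :=
  [/\ U^T *m U = 1%:M, V^T *m V = 1%:M,
      is_diag_mx S, (forall i j, 0 <= S i j) & M = U *m S *m V^T].

(* Applied to the singular value matrix S, this is V1 Sigma1^-1 U1^T written
   in the bases given by V and U. *)
Definition trunc_inv (R : realType) (eps : R) (m n : nat) (S : 'M[R]_(m, n)) :
    'M[R]_(n, m) :=
  \matrix_(j, i) (if eps < S i j then (S i j)^-1 else 0).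

(* Every matrix has an SVD, and V * trunc_inv eps S * U^T does not depend on
   its choice, so that eps_pinv is well defined, see eps_pinvE. *)
Section SVD.
Context (R : realType).

Let dot n (x y : 'rV[R]_n) : R := (x *m y^T) 0 0.

Let dotE n (x y : 'rV[R]_n) : x *m y^T = (dot x y)%:M.
Proof. exact: mx11_scalar. Qed.

Let dotC n (x y : 'rV[R]_n) : dot x y = dot y x.
Proof. by rewrite /dot -[LHS]trace_mx11 -mxtrace_tr trmx_mul trmxK trace_mx11. Qed.

Let dotDl n (x y z : 'rV[R]_n) : dot (x + y) z = dot x z + dot y z.
Proof. by rewrite /dot mulmxDl mxE. Qed.

Let dotZl n a (x z : 'rV[R]_n) : dot (a *: x) z = a * dot x z.
Proof. by rewrite /dot -scalemxAl mxE. Qed.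

Let dotDr n (x y z : 'rV[R]_n) : dot z (x + y) = dot z x + dot z y.
Proof. by rewrite !(dotC z) dotDl. Qed.

Let dotZr n a (x z : 'rV[R]_n) : dot z (a *: x) = a * dot z x.
Proof. by rewrite !(dotC z) dotZl. Qed.

Let dot_sum n (x : 'rV[R]_n) : dot x x = \sum_j x 0 j ^+ 2.
Proof. by rewrite /dot mxE; apply: eq_bigr => j _; rewrite !mxE. Qed.

Let dot_ge0 n (x : 'rV[R]_n) : 0 <= dot x x.
Proof. by rewrite dot_sum sumr_ge0// => j _; exact: sqr_ge0. Qed.

Let dot_eq0 n (x : 'rV[R]_n) : dot x x = 0 -> x = 0.
Proof.
rewrite dot_sum => /eqP; rewrite psumr_eq0 => [/allP x0|j _]; last exact: sqr_ge0.
apply/rowP => j; rewrite mxE; apply/eqP; rewrite -sqrf_eq0.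
by apply: x0; rewrite mem_index_enum.
Qed.

Let dot_continuous n (G : 'M[R]_n) : continuous (fun x : 'rV[R]_n => dot (x *m G) x).
Proof.
rewrite (_ : (fun _ => _) =
  (fun x : 'rV[R]_n => \sum_j (\sum_i x 0 i * G i j) * x 0 j)); last first.
  by apply/funext => x; rewrite /dot mxE; apply: eq_bigr => j _; rewrite !mxE.
have csum (F : 'I_n -> 'rV[R]_n -> R) : (forall i, continuous (F i)) ->
    continuous (fun x => \sum_i F i x).
  move=> cF; elim: (index_enum _) => [|i r IH].
    rewrite (_ : (fun _ => _) = cst 0); first exact: cst_continuous.
    by apply/funext => x; rewrite big_nil.
  rewrite (_ : (fun _ => _) = F i \+ (fun x => \sum_(i <- r) F i x)).
    by move=> x; exact: cvgD (cF i x) (IH x).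
  by apply/funext => x; rewrite big_cons.
apply: (csum) => j.
have cj k : continuous (fun x : 'rV[R]_n => x 0 k) by exact: coord_continuous.
have ci : continuous (fun x : 'rV[R]_n => \sum_i x 0 i * G i j).
  by apply: csum => i x; exact: cvgM (cj i x) (cvg_cst _).
by move=> x; exact: cvgM (ci x) (cj j x).
Qed.

Let exists_top n (G : 'M[R]_n.+1) :
  exists2 u : 'rV[R]_n.+1, dot u u = 1 &
    forall x, dot (x *m G) x <= dot (u *m G) u * dot x x.
Proof.
pose S := [set x : 'rV[R]_n.+1 | dot x x = 1].
have S0 : S !=set0.
  exists (delta_mx 0 0); rewrite /S/= dot_sum (bigD1 0)//= big1 => [|j /negPf j0].
    by rewrite !mxE !eqxx addr0 expr1n.
  by rewrite !mxE j0 andbF expr0n.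
have cS : compact S.
  apply: bounded_closed_compact.
    exists 1; split=> // M M1 x; rewrite /S/= dot_sum => x1.
    rewrite /Num.Def.normr/= mx_normrE; apply/bigmax_leP; split=> [|[i j] _ /=].
      by rewrite ltW// (lt_trans ltr01).
    rewrite ord1 (le_trans _ (ltW M1))// -(expr_le1 (n := 2))//.
    rewrite real_normK ?num_real// -x1 (bigD1 j)//=.
    by rewrite lerDl sumr_ge0// => k _; exact: sqr_ge0.
  rewrite (_ : S = (fun x => dot (x *m 1%:M) x) @^-1` [set 1]); last first.
    by apply/funext => x; rewrite /S/= mulmx1.
  apply: preimage_closed; last exact: closed_eq.
  by move=> x _; exact: dot_continuous.
have [u uS umax] := EVT_max_rV S0 cS
  (@continuous_subspaceT _ _ _ _ (@dot_continuous _ G)).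
have u1 : dot u u = 1 by rewrite inE in uS.
exists u => // x; have [->|x0] := eqVneq x 0.
  by rewrite mul0mx /dot !mul0mx !mxE mulr0.
have xx : 0 < dot x x.
  by rewrite lt_neqAle dot_ge0 andbT eq_sym; apply: contraNneq x0 => /dot_eq0 ->.
have := umax ((Num.sqrt (dot x x))^-1 *: x).
rewrite -scalemxAl dotZl dotZr mulrA -invfM -expr2 sqr_sqrtr// => H.
rewrite mulrC -ler_pdivrMl//; apply: H; rewrite inE /S/=.
by rewrite dotZl dotZr mulrA -invfM -expr2 sqr_sqrtr// mulVf// gt_eqF.
Qed.

Let exists_pair m n (M : 'M[R]_(m.+1, n.+1)) :
  exists (u : 'rV[R]_m.+1) (v : 'rV[R]_n.+1) (s : R),
    [/\ dot u u = 1, dot v v = 1, 0 <= s, u *m M = s *: v &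
        v *m M^T = s *: u].
Proof.
have [u u1 umax] := exists_top (M *m M^T).
set c := dot (u *m _) u in umax.
have cE x : dot (x *m (M *m M^T)) x = dot (x *m M) (x *m M).
  by rewrite /dot trmx_mul !mulmxA.
have c0 : 0 <= c by rewrite /c cE.
have uE : u *m (M *m M^T) = c *: u.
  have [w wE] : exists w, w = u *m (M *m M^T) - c *: u by eexists.
  suff : dot w w = 0 by move=> /dot_eq0 w0; apply/subr0_eq; rewrite -wE.
  set e := dot w w; have e0 : 0 <= e by exact: dot_ge0.
  set f := c * e - dot (w *m (M *m M^T)) w.
  have f0 : 0 <= f by rewrite subr_ge0.
  have uw : dot (u *m (M *m M^T)) w = e + c * dot u w.
    by rewrite -dotZl -dotDl wE subrK.
  have wu : dot (w *m (M *m M^T)) u = e + c * dot u w.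
    by rewrite -uw dotC /dot !trmx_mul trmxK !mulmxA.
  have key t : 2 * t * e <= t ^+ 2 * f.
    have := umax (u + t *: w).
    rewrite mulmxDl -scalemxAl !(dotDl, dotDr, dotZl, dotZr) -/c u1 -/e uw wu.
    by rewrite (dotC w u) /f; lra.
  have f1 : 0 < f + 1 by rewrite ltr_wpDl.
  have := ler_wpM2r (ltW (mulr_gt0 f1 f1)) (key (e / (f + 1))).
  rewrite [X in X <= _ -> _](_ : _ = 2 * e ^+ 2 * (f + 1)); last by field; rewrite gt_eqF.
  rewrite [X in _ <= X -> _](_ : _ = e ^+ 2 * f); last by field; rewrite gt_eqF.
  move=> H; apply/eqP; rewrite -sqrf_eq0 eq_le sqr_ge0 andbT.
  have := mulr_ge0 (sqr_ge0 e) f0; nra.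
pose s := Num.sqrt c.
have [s0|s0] := eqVneq s 0.
  have M0 (x : 'rV_m.+1) : x *m M = 0.
    apply: dot_eq0; apply/eqP; rewrite eq_le dot_ge0 andbT -cE.
    by rewrite (le_trans (umax x))// (_ : c = 0) ?mul0r//;
       rewrite -(sqr_sqrtr c0) -/s s0 expr0n.
  have {}M0 : M = 0 by apply/row_matrixP => i; rewrite rowE M0 row0.
  exists u, (delta_mx 0 0), 0; split=> //; rewrite ?scale0r//.
  - rewrite dot_sum (bigD1 0)//= big1 => [|j /negPf j0].
      by rewrite !mxE !eqxx addr0 expr1n.
    by rewrite !mxE j0 andbF expr0n.
  - by rewrite M0 mulmx0.
  - by rewrite M0 trmx0 mulmx0.
exists u, (s^-1 *: (u *m M)), s; split=> //.
- rewrite dotZl dotZr -cE -/c mulrA -invfM -expr2 sqr_sqrtr// mulVf//.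
  by apply: contraNneq s0 => c00; rewrite /s c00 sqrtr0.
- exact: sqrtr_ge0.
- by rewrite scalerA divff// scale1r.
- rewrite -scalemxAl -mulmxA uE scalerA -(sqr_sqrtr c0) -/s expr2 mulKf//.
Qed.

Let householder n (u : 'rV[R]_n.+1) : dot u u = 1 ->
  exists H : 'M[R]_n.+1, H^T *m H = 1%:M /\ delta_mx 0 0 *m H = u.
Proof.
move=> u1; set e : 'rV[R]_n.+1 := delta_mx 0 0.
have e1 : dot e e = 1.
  rewrite dot_sum (bigD1 0)//= big1 => [|j /negPf j0].
    by rewrite !mxE !eqxx addr0 expr1n.
  by rewrite !mxE j0 andbF expr0n.
have [<-|eu] := eqVneq e u.
  by exists 1%:M; rewrite trmx1 mulmx1; split=> //; rewrite mulmx1.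
set w := e - u; set q := dot w w.
have q0 : q != 0 by apply: contraNneq eu => /dot_eq0/subr0_eq ->.
have qE : q = 2 * dot e w.
  rewrite /q /w -scaleN1r !(dotDl, dotDr, dotZl, dotZr) e1 u1 (dotC u e); ring.
pose H := 1%:M - (2 / q) *: (w^T *m w).
have HT : H^T = H by rewrite /H linearB linearZ /= trmx1 trmx_mul trmxK.
exists H; split.
  have WW : (w^T *m w) *m (w^T *m w) = q *: (w^T *m w).
    by rewrite mulmxA -(mulmxA w^T) dotE mul_mx_scalar -scalemxAl.
  rewrite HT /H; move: (w^T *m w) WW => W WW.
  rewrite mulmxBr mulmx1 mulmxBl mul1mx -scalemxAl -scalemxAr WW !scalerA.
  rewrite (_ : 2 / q * (2 / q) * q = 2 / q + 2 / q); last by field.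
  by rewrite scalerDl opprB addrK subrK.
rewrite /H mulmxBr mulmx1 -scalemxAr mulmxA dotE mul_scalar_mx scalerA.
rewrite (_ : 2 / q * _ = 1) ?scale1r; first by rewrite /w opprB addrC subrK.
rewrite [in LHS]qE; field.
by apply: contraNneq q0 => d0; rewrite qE d0 mulr0.
Qed.

Let block_first m n (N : 'M[R]_(1 + m, 1 + n)) (s : R) :
  (forall j, N 0 j = s * (j == 0)%:R) -> (forall i, N i 0 = s * (i == 0)%:R) ->
  N = block_mx s%:M 0 0 (drsubmx N).
Proof.
move=> N0j Ni0.
have l0 k : lshift k (0 : 'I_1) = 0 :> 'I_(1 + k) by exact/val_inj.
rewrite -[LHS]submxK; congr block_mx; apply/matrixP => i j.
- by rewrite 2!mxE !ord1 !l0 N0j [RHS]mxE mulr1.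
- by rewrite 2!mxE ord1 l0 N0j [RHS]mxE mulr0.
- by rewrite 2!mxE [j]ord1 l0 Ni0 [RHS]mxE mulr0.
Qed.

Let svd_block m n (B : 'M[R]_(m, n)) U S V (s : R) : 0 <= s ->
  is_svd B U S V ->
  is_svd (block_mx s%:M 0 0 B : 'M[R]_(1 + m, 1 + n))
    (block_mx 1%:M 0 0 U) (block_mx s%:M 0 0 S) (block_mx 1%:M 0 0 V).
Proof.
move=> s0 [UU VV Sd Sp ->].
have orthB k (W : 'M[R]_k) : W^T *m W = 1%:M ->
    (block_mx 1%:M 0 0 W : 'M[R]_(1 + k))^T *m block_mx 1%:M 0 0 W = 1%:M.
  move=> WW; rewrite tr_block_mx !trmx0 trmx1 mulmx_block !(mulmx0, mul0mx).
  by rewrite !(addr0, add0r) mul1mx WW -scalar_mx_block.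
split; [exact: orthB|exact: orthB| | |].
- by rewrite is_diag_block_mx// !eqxx Sd scalar_mx_is_diag.
- move=> i j; case: (split_ordP i) => i' ->; case: (split_ordP j) => j' ->.
  + by rewrite block_mxEul mxE mulrb; case: ifP.
  + by rewrite block_mxEur mxE.
  + by rewrite block_mxEdl mxE.
  + by rewrite block_mxEdr.
rewrite tr_block_mx !trmx0 trmx1 !mulmx_block.
by rewrite !(mulmx0, mul0mx, mulmx1, mul1mx, addr0, add0r).
Qed.

Let svd_mul m n (N : 'M[R]_(m, n)) U S V (P : 'M[R]_m) (Q : 'M[R]_n) :
  P *m P^T = 1%:M -> Q *m Q^T = 1%:M -> is_svd N U S V ->
  is_svd (P^T *m N *m Q) (P^T *m U) S (Q^T *m V).
Proof.
move=> PP QQ [UU VV Sd Sp ->]; split=> //.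
- by rewrite trmx_mul trmxK mulmxA -(mulmxA _ P) PP mulmx1.
- by rewrite trmx_mul trmxK mulmxA -(mulmxA _ Q) QQ mulmx1.
by rewrite trmx_mul trmxK !mulmxA.
Qed.

Lemma svd_exists m n (M : 'M[R]_(m, n)) : exists U S V, is_svd M U S V.
Proof.
elim: m n M => [|m IH] [|n] M.
1-3: exists 1%:M, 0, 1%:M; split; rewrite ?trmx1 ?mulmx1//;
  [exact: mx0_is_diag|by move=> i j; rewrite mxE|].
- by apply/matrixP => -[].
- by apply/matrixP => -[].
- by apply/matrixP => i [].
have [u [v [s [u1 v1 s0 uM vM]]]] := exists_pair M.
have [P [PP eP]] := householder u1; have [Q [QQ eQ]] := householder v1.
have PP' := mulmx1C PP; have QQ' := mulmx1C QQ.
pose N := P *m M *m Q^T.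
have [U [S [V svdB]]] := IH _ (drsubmx (N : 'M[R]_(1 + m, 1 + n))).
have N1 : (delta_mx 0 0 : 'rV[R]_m.+1) *m N = s *: delta_mx 0 0.
  by rewrite /N !mulmxA eP uM -scalemxAl -eQ -mulmxA QQ' mulmx1.
have N2 : (delta_mx 0 0 : 'rV[R]_n.+1) *m N^T = s *: delta_mx 0 0.
  by rewrite /N !trmx_mul trmxK !mulmxA eQ vM -scalemxAl -eP -mulmxA PP' mulmx1.
have N0j j : N 0 j = s * (j == 0)%:R.
  by move: N1 => /rowP /(_ j); rewrite -rowE !mxE eqxx.
have Ni0 i : N i 0 = s * (i == 0)%:R.
  by move: N2 => /rowP /(_ i); rewrite -rowE !mxE eqxx.
have NB : N = (block_mx s%:M 0 0 (drsubmx (N : 'M[R]_(1 + m, 1 + n)))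
    : 'M[R]_(1 + m, 1 + n)) by exact: block_first.
have := svd_mul PP' QQ' (svd_block s0 svdB); rewrite -NB.
rewrite (_ : P^T *m N *m Q = M) => [svdM|]; last first.
  by rewrite /N !mulmxA PP mul1mx -mulmxA QQ mulmx1.
by do 3 eexists; exact: svdM.
Qed.

Let gram_diag m n (S : 'M[R]_(m, n)) : is_diag_mx S -> is_diag_mx (S^T *m S).
Proof.
move=> /is_diag_mxP Sd; apply/is_diag_mxP => i j ij.
rewrite mxE big1// => k _; rewrite mxE; have [ki|ki] := eqVneq (k : nat) i.
  by rewrite (Sd k j) ?mulr0// ki.
by rewrite Sd ?mul0r.
Qed.

Let trunc_inv_diag (a : R) n (d : 'rV[R]_n) : 0 <= a ->
  trunc_inv a (diag_mx d) =
  diag_mx (\row_j if a < d 0 j then (d 0 j)^-1 else 0).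
Proof.
move=> a0; apply/matrixP => i j; rewrite !mxE eq_sym.
by have [->|_] := eqVneq i j; rewrite ?mulr1n// !mulr0n ltNge a0.
Qed.

Let trunc_invE (a : R) m n (S : 'M[R]_(m, n)) : 0 <= a ->
  is_diag_mx S -> (forall i j, 0 <= S i j) ->
  trunc_inv a S = trunc_inv (a ^+ 2) (S^T *m S) *m S^T.
Proof.
move=> a0 Sd S0; have /diag_mxP[d dE] := gram_diag Sd.
rewrite dE trunc_inv_diag ?sqr_ge0// mul_diag_mx.
apply/matrixP => j i; rewrite !mxE.
have [->|Sij] := eqVneq (S i j) 0; first by rewrite mulr0 ltNge a0.
have ij : i = j :> nat.
  by move/is_diag_mxP : Sd => Sd; apply/eqP; apply: contraNT Sij => /Sd ->.
have -> : d 0 j = S i j ^+ 2.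
  have /matrixP/(_ j j) := dE; rewrite !mxE eqxx mulr1n => <-.
  rewrite (bigD1 i)//= big1 ?addr0 ?mxE// => k ki.
  by rewrite (is_diag_mxP Sd k j) ?mulr0// -ij.
rewrite ltr_pXn2r// ?nnegrE//; case: ifP => _; last by rewrite mul0r.
by rewrite expr2 invfM mulfVK.
Qed.

Lemma trunc_inv_svd_uniq (eps : R) m n (M : 'M[R]_(m, n)) U S V U' S' V' :
  0 <= eps -> is_svd M U S V -> is_svd M U' S' V' ->
  V *m trunc_inv eps S *m U^T = V' *m trunc_inv eps S' *m U'^T.
Proof.
move=> eps0 [UU VV Sd S0 ME] [UU' VV' Sd' S0' ME'].
have [UUc VVc] := (mulmx1C UU, mulmx1C VV).
pose K := U'^T *m U; pose L := V'^T *m V.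
have KS : K *m S = S' *m L.
  have -> : S = U^T *m M *m V.
    by rewrite ME !mulmxA UU mul1mx -mulmxA VV mulmx1.
  by rewrite ME' /K /L !mulmxA -(mulmxA _ U) UUc mulmx1 UU' mul1mx.
have LS : L *m S^T = S'^T *m K.
  have -> : S^T = V^T *m M^T *m U.
    by rewrite ME !trmx_mul trmxK !mulmxA VV mul1mx -mulmxA UU mulmx1.
  by rewrite ME' !trmx_mul trmxK /K /L !mulmxA -(mulmxA _ V) VVc mulmx1 VV' mul1mx.
suff E : L *m trunc_inv eps S = trunc_inv eps S' *m K.
  have := congr1 (fun Z => V' *m Z *m U^T) E.
  rewrite /K /L !mulmxA (mulmx1C VV') mul1mx => ->.
  by rewrite -!mulmxA UUc mulmx1.
clearbody K L.
have LD : L *m (S^T *m S) = (S'^T *m S') *m L.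
  by rewrite mulmxA LS -mulmxA KS mulmxA.
rewrite (trunc_invE eps0 Sd S0) (trunc_invE eps0 Sd' S0').
rewrite mulmxA -[RHS]mulmxA -LS [RHS]mulmxA; congr (_ *m _).
have [/diag_mxP[D DE] /diag_mxP[D' DE']] := (gram_diag Sd, gram_diag Sd').
move: LD; rewrite DE DE' => /matrixP LD.
rewrite !trunc_inv_diag ?sqr_ge0// mul_mx_diag mul_diag_mx.
apply/matrixP => i j; rewrite !mxE; have := LD i j.
rewrite mul_mx_diag mul_diag_mx !mxE mulrC => LDij.
have [->|Lij] := eqVneq (L i j) 0; first by rewrite mul0r mulr0.
by rewrite (mulIf Lij LDij) mulrC.
Qed.
End SVD.

Definition eps_pinv (R : realType) (eps : R) (m n : nat) (M : 'M[R]_(m, n)) :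
    'M[R]_(n, m) :=
  xget 0 [set Z | exists U S V, is_svd M U S V /\
                                Z = V *m trunc_inv eps S *m U^T].

Lemma eps_pinvE (R : realType) (eps : R) m n (M : 'M[R]_(m, n)) U S V :
  0 <= eps -> is_svd M U S V ->
  eps_pinv eps M = V *m trunc_inv eps S *m U^T.
Proof.
move=> eps0 svdM; rewrite /eps_pinv; case: xgetP => [Z _ | /(_ _)].
  by move=> [U' [S' [V' [svdM' ->]]]]; exact: trunc_inv_svd_uniq svdM' svdM.
by move=> /(_ (V *m trunc_inv eps S *m U^T))[]; exists U, S, V.
Qed.

(* Main.v *)
Require Import Defs.
From mathcomp Require Import all_boot all_order all_algebra.
From mathcomp Require Import all_classical all_reals all_analysis.
From mathcomp Require Import ring lra.

Import Order.TTheory GRing.Theory Num.Theory.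
Local Open Scope ring_scope.

(** The bound comes from processing the modes one after the other. Let
    [B] be the product of [A] with some of the matrices [P k]. Multiplying
    by one more matrix gives
      [A - B x_k P k = (A - A x_k P k) + (A - B) x_k P k],
    because the mode product is linear in the tensor. The first term has norm
    at most [e], and the norm of the second is at most [spectral_norm (P k)]
    times that of [A - B] ([tfrob_modeprod]), hence at most [t] times it, where
    [t] bounds all the [1 + spectral_norm (P k)]. So the error after each
    step is at most [e + t * x] for the error [x] before it, and induction on
    the number of modes gives [x * t <= e * ((1 + t) ^+ m - 1)] for the error [x] after [m] modes
    ([tfrob_sub_foldl_modeprod]). *)

(** * The Frobenius norm *)

(** Cauchy-Schwarz; with [p], [q], [r] the three sums, the vector [r a - q b],
    a multiple of the component of [a] orthogonal to [b], has squared norm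
    [r (p r - q ^ 2)]. *)
Lemma sum_cauchy_schwarz (R : realDomainType) (I : finType) (a b : I -> R) :
  (\sum_i a i * b i) ^+ 2 <= (\sum_i a i ^+ 2) * (\sum_i b i ^+ 2).
Proof.
set q := \sum_i a i * b i; set p := \sum_i a i ^+ 2; set r := \sum_i b i ^+ 2.
have r0 : 0 <= r by apply: sumr_ge0 => i _; exact: sqr_ge0.
have [rE|rN0] := eqVneq r 0.
  have b0 i : b i = 0.
    apply/eqP; rewrite -sqrf_eq0; move/eqP: rE.
    rewrite psumr_eq0 => [/allP/(_ i)|j _]; last exact: sqr_ge0.
    by apply; rewrite mem_index_enum.
  by rewrite rE mulr0 /q big1 ?expr0n// => i _; rewrite b0 mulr0.
have r_gt0 : 0 < r by rewrite lt_neqAle eq_sym rN0.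
have : 0 <= \sum_i (r * a i - q * b i) ^+ 2.
  by apply: sumr_ge0 => i _; exact: sqr_ge0.
have -> : \sum_i (r * a i - q * b i) ^+ 2 = r * (p * r - q ^+ 2).
  transitivity (\sum_i (r ^+ 2 * a i ^+ 2 - 2 * r * q * (a i * b i)
                       + q ^+ 2 * b i ^+ 2)).
    by apply: eq_bigr => i _; ring.
  by rewrite big_split sumrB /= -!mulr_sumr -/p -/q -/r; ring.
by rewrite pmulr_rge0// subr_ge0.
Qed.

Lemma tfrob_ge0 {R : realType} {d} {n : 'I_d -> nat} (A : tensor R n) :
  0 <= tfrob A.
Proof. exact: sqrtr_ge0. Qed.

Lemma tfrob_sqr {R : realType} {d} {n : 'I_d -> nat} (A : tensor R n) :
  tfrob A ^+ 2 = \sum_i A i ^+ 2.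
Proof. by rewrite sqr_sqrtr// sumr_ge0// => i _; exact: sqr_ge0. Qed.

Lemma tfrob0 (R : realType) d (n : 'I_d -> nat) : tfrob (0 : tensor R n) = 0.
Proof. by rewrite /tfrob big1 ?sqrtr0// => i _; rewrite ffunE expr0n. Qed.

Lemma tfrobD {R : realType} {d} {n : 'I_d -> nat} (A B : tensor R n) :
  tfrob (A + B) <= tfrob A + tfrob B.
Proof.
have := sum_cauchy_schwarz _ _ A B; rewrite -!tfrob_sqr -exprMn => AB.
have {}AB : \sum_i A i * B i <= tfrob A * tfrob B.
  rewrite (le_trans (ler_norm _))// -(ler_pXn2r (n := 2))// ?nnegrE//.
    by rewrite real_normK ?num_real.
  by rewrite mulr_ge0 ?tfrob_ge0.
rewrite -(ler_pXn2r (n := 2))// ?nnegrE ?addr_ge0 ?tfrob_ge0//.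
have -> : tfrob (A + B) ^+ 2 =
    tfrob A ^+ 2 + 2 * (\sum_i A i * B i) + tfrob B ^+ 2.
  rewrite !tfrob_sqr mulr_sumr -!big_split /=.
  by apply: eq_bigr => i _; rewrite ffunE; ring.
by lra.
Qed.

(** * The spectral norm *)

Lemma frob_ge0 {R : realType} {m n} (A : 'M[R]_(m, n)) : 0 <= frob A.
Proof. exact: sqrtr_ge0. Qed.

Lemma frob_sqr {R : realType} {m n} (A : 'M[R]_(m, n)) :
  frob A ^+ 2 = \sum_i \sum_j A i j ^+ 2.
Proof.
rewrite sqr_sqrtr//.
by do 2 (apply: sumr_ge0 => ? _); exact: sqr_ge0.
Qed.

Lemma frob_col_sqr {R : realType} {n} (x : 'cV[R]_n) :
  frob x ^+ 2 = \sum_i x i 0 ^+ 2.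
Proof. by rewrite frob_sqr; apply: eq_bigr => i _; rewrite big_ord1. Qed.

Lemma frob0 (R : realType) m n : frob (0 : 'M[R]_(m, n)) = 0.
Proof.
by rewrite /frob big1 ?sqrtr0// => i _; rewrite big1// => j _; rewrite mxE expr0n.
Qed.

Lemma frobZ {R : realType} {m n} (a : R) (A : 'M[R]_(m, n)) :
  frob (a *: A) = `|a| * frob A.
Proof.
rewrite /frob -sqrtr_sqr -sqrtrM ?sqr_ge0// mulr_sumr; congr Num.sqrt.
apply: eq_bigr => i _; rewrite mulr_sumr.
by apply: eq_bigr => j _; rewrite mxE exprMn.
Qed.

Lemma frob_col_eq0 {R : realType} {n} (x : 'cV[R]_n) : frob x = 0 -> x = 0.
Proof.
move=> x0; apply/colP => i; rewrite mxE; apply/eqP; rewrite -sqrf_eq0.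
have /eqP := frob_col_sqr x; rewrite x0 expr0n eq_sym psumr_eq0.
  by move=> /allP/(_ i); apply; rewrite mem_index_enum.
by move=> j _; exact: sqr_ge0.
Qed.

(** This crude bound makes the supremum that defines the spectral norm that of
    a bounded set. *)
Lemma frob_mulmx_col {R : realType} {m n} (M : 'M[R]_(m, n)) (x : 'cV[R]_n) :
  frob (M *m x) <= frob M * frob x.
Proof.
rewrite -(ler_pXn2r (n := 2))// ?nnegrE ?mulr_ge0 ?frob_ge0//.
rewrite exprMn !frob_col_sqr frob_sqr mulr_suml; apply: ler_sum => i _.
by rewrite mxE; exact: sum_cauchy_schwarz.
Qed.

Lemma frob_le_spectral_norm {R : realType} {m n} (M : 'M[R]_(m, n))
    (x : 'cV[R]_n) :
  frob x <= 1 -> frob (M *m x) <= spectral_norm M.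
Proof.
move=> x1; apply: ub_le_sup; last by exists x.
exists (frob M) => _ [y /= y1 <-].
by rewrite (le_trans (frob_mulmx_col M y))// ler_piMr ?frob_ge0.
Qed.

Lemma spectral_norm_ge0 {R : realType} {m n} (M : 'M[R]_(m, n)) :
  0 <= spectral_norm M.
Proof.
apply: le_trans (frob_ge0 (M *m (0 : 'cV_n))) _.
by rewrite frob_le_spectral_norm// frob0.
Qed.

Lemma spectral_normP {R : realType} {m n} (M : 'M[R]_(m, n)) (x : 'cV[R]_n) :
  frob (M *m x) <= spectral_norm M * frob x.
Proof.
have [x0|x0] := eqVneq (frob x) 0.
  by rewrite x0 mulr0 (frob_col_eq0 x x0) mulmx0 frob0.
have x_gt0 : 0 < frob x by rewrite lt_neqAle eq_sym x0 frob_ge0.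
have := frob_le_spectral_norm M ((frob x)^-1 *: x).
rewrite -scalemxAr !frobZ ger0_norm ?invr_ge0 ?frob_ge0// mulVf// => /(_ (lexx _)).
by rewrite mulrC ler_pdivrMr.
Qed.

(** * Mode products *)

Notation set_mode k i s := (finfun (@eqtype.dfwith _ _ i k s)).

Lemma set_mode_eq {d} {n : 'I_d -> nat} (k : 'I_d) (i : tindex n)
    (s : 'I_(n k)) : (set_mode k i s : tindex n) k = s.
Proof. by rewrite ffunE dfwith_in. Qed.

Lemma set_mode_set_mode {d} {n : 'I_d -> nat} (k : 'I_d) (i : tindex n)
    (s t : 'I_(n k)) :
  (set_mode k (set_mode k i s : tindex n) t : tindex n) = set_mode k i t.
Proof.
apply/ffunP => j; rewrite !ffunE; have [<-|kj] := eqVneq k j.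
  by rewrite !dfwith_in.
by rewrite !dfwith_out// ffunE dfwith_out.
Qed.

Lemma set_mode_id {d} {n : 'I_d -> nat} (k : 'I_d) (i : tindex n) :
  (set_mode k i (i k) : tindex n) = i.
Proof.
apply/ffunP => j; rewrite ffunE; have [<-|kj] := eqVneq k j.
  by rewrite dfwith_in.
by rewrite dfwith_out.
Qed.

(** Each mode-[k] fibre, a set of [n k] multi-indices that differ only in
    position [k], is run through once for each of its members. The reason is
    that exchanging [s] with the entry [i k] is an involution of the pairs
    [(i, s)]. *)
Lemma sum_set_mode (R : nzRingType) d (n : 'I_d -> nat) (k : 'I_d)
    (F : tindex n -> R) :
  \sum_(i : tindex n) \sum_(s < n k) F (set_mode k i s) = (n k)%:R * \sum_i F i.
Proof.
rewrite pair_big /=.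
pose h (u : tindex n * 'I_(n k)) := (set_mode k u.1 u.2 : tindex n, u.1 k).
have hK : involutive h.
  move=> [i s]; rewrite /h /= set_mode_set_mode set_mode_id.
  by congr (_, _); rewrite set_mode_eq.
rewrite (reindex_inj (inv_inj hK)) /=.
under eq_bigr do rewrite set_mode_set_mode set_mode_id.
rewrite -(pair_big xpredT xpredT (fun i _ => F i)) /= mulr_sumr.
by apply: eq_bigr => i _; rewrite sumr_const card_ord mulr_natl.
Qed.

Lemma modeprodB {R : realType} {d} {n : 'I_d -> nat} (A B : tensor R n)
    (k : 'I_d) (M : 'M[R]_(n k)) :
  modeprod (A - B) M = modeprod A M - modeprod B M.
Proof.
apply/ffunP => i; rewrite !ffunE -sumrB.
by apply: eq_bigr => s _; rewrite !ffunE mulrBl.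
Qed.

(** The mode product applies [M] to every mode-[k] fibre of [B]. Summing over
    all multi-indices counts each fibre [n k] times, on both sides of the
    inequality, so that the fibrewise bound [spectral_normP] is enough. *)
Lemma tfrob_modeprod {R : realType} {d} {n : 'I_d -> nat} (B : tensor R n)
    (k : 'I_d) (M : 'M[R]_(n k)) :
  tfrob (modeprod B M) <= spectral_norm M * tfrob B.
Proof.
have [nk0|nk_gt0] := posnP (n k).
  (* There is no multi-index, so both norms are empty sums. *)
  have T0 (C : tensor R n) : tfrob C = 0.
    by rewrite -(tfrob0 R _ n); congr tfrob; apply/ffunP => i; case: (i k) => ?;
       rewrite nk0.
  by rewrite !T0 mulr0.
rewrite -(ler_pXn2r (n := 2))//
  ?nnegrE ?mulr_ge0 ?tfrob_ge0 ?spectral_norm_ge0//.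
have nkR : 0 < (n k)%:R :> R by rewrite ltr0n.
rewrite exprMn !tfrob_sqr -(ler_pM2l nkR) mulrCA.
rewrite -(sum_set_mode _ _ _ k (fun i => modeprod B M i ^+ 2)).
rewrite -(sum_set_mode _ _ _ k (fun i => B i ^+ 2)) mulr_sumr.
apply: ler_sum => i _; pose x : 'cV[R]_(n k) := \col_s B (set_mode k i s).
have -> : \sum_s modeprod B M (set_mode k i s) ^+ 2 = frob (M *m x) ^+ 2.
  rewrite frob_col_sqr; apply: eq_bigr => a _; congr (_ ^+ 2).
  rewrite ffunE mxE; apply: eq_bigr => s _.
  by rewrite set_mode_set_mode set_mode_eq mxE mulrC.
have -> : \sum_s B (set_mode k i s) ^+ 2 = frob x ^+ 2.
  by rewrite frob_col_sqr; apply: eq_bigr => s _; rewrite mxE.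
rewrite -exprMn ler_pXn2r ?nnegrE ?mulr_ge0 ?frob_ge0 ?spectral_norm_ge0//.
exact: spectral_normP.
Qed.

(** * Accumulation of the error *)

(** The right-hand side solves the recurrence [x' = e + (1 + t) x], multiplied
    by [t]; the errors satisfy the slower one with factor [t]. *)
Lemma tfrob_sub_foldl_modeprod {R : realType} {d} {n : 'I_d -> nat}
    (A : tensor R n) (P : forall k, 'M[R]_(n k)) (e t : R) (ks : seq 'I_d) :
  0 <= e -> 0 <= t ->
  (forall k, tfrob (A - modeprod A (P k)) <= e) ->
  (forall k, 1 + spectral_norm (P k) <= t) ->
  tfrob (A - foldl (fun B k => modeprod B (P k)) A ks) * t
    <= e * ((1 + t) ^+ size ks - 1).
Proof.
move=> e0 t0 Pe Pt; elim/last_ind: ks => [|ks k IH].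
  by rewrite /= subrr tfrob0 mul0r expr0 subrr mulr0.
rewrite foldl_rcons size_rcons; set B := foldl _ _ _ in IH *.
have step : tfrob (A - modeprod B (P k)) <= e + t * tfrob (A - B).
  have -> : A - modeprod B (P k) =
      (A - modeprod A (P k)) + modeprod (A - B) (P k).
    by rewrite modeprodB addrA subrK.
  rewrite (le_trans (tfrobD _ _))// lerD ?Pe//.
  rewrite (le_trans (tfrob_modeprod _ _ _))// ler_wpM2r ?tfrob_ge0//.
  by rewrite (le_trans _ (Pt k))// lerDr.
apply: le_trans (ler_wpM2r t0 step) _.
rewrite mulrDl -mulrA.
apply: le_trans (lerD (lexx _) (ler_wpM2l t0 IH)) _.
have c1 : 1 <= (1 + t) ^+ size ks by rewrite exprn_ege1// lerDl.
rewrite exprS; set c := _ ^+ size ks in c1 *.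
(* A growth factor [1 + t] would give equality; the factor [t] leaves the
   slack [e (c - 1)]. *)
rewrite -subr_ge0 (_ : _ - _ = e * (c - 1)); last by ring.
by rewrite mulr_ge0// subr_ge0.
Qed.

Lemma tfrob_sub_multiprod {R : realType} {d} {n : 'I_d -> nat}
    (A : tensor R n) (P : forall k, 'M[R]_(n k))
    (e := \big[Num.max/0]_(k < d) tfrob (A - modeprod A (P k)))
    (t := \big[Num.max/0]_(k < d) (1 + spectral_norm (P k))) :
  (0 < d)%N ->
  tfrob (A - multiprod A P) <= e / t * ((1 + t) ^+ d - 1).
Proof.
move=> d_gt0; have t_ge k : 1 + spectral_norm (P k) <= t by exact: le_bigmax.
have t_gt0 : 0 < t.
  apply: lt_le_trans (t_ge (Ordinal d_gt0)).
  by rewrite ltr_pwDl ?spectral_norm_ge0.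
have e_ge0 : 0 <= e by exact: bigmax_ge_id.
have e_ge k : tfrob (A - modeprod A (P k)) <= e by exact: le_bigmax.
rewrite mulrAC ler_pdivlMr//.
have := tfrob_sub_foldl_modeprod A P e t (enum 'I_d) e_ge0 (ltW t_gt0) e_ge t_ge.
by rewrite size_enum_ord.
Qed.

Theorem theorem5p6 (R : realType) (d : nat) (hd : (0 < d)%N)
    (n : 'I_d -> nat) (A : tensor R n) (eps : R) (heps : 0 < eps)
    (r l : 'I_d -> nat)
    (X : forall k : 'I_d, 'M[R]_(\prod_(j < d | j != k) n j, r k))
    (Y : forall k : 'I_d, 'M[R]_(n k, r k + l k))
    (dA : forall k : 'I_d, 'M[R]_(n k, \prod_(j < d | j != k) n j)) :
  let At (k : 'I_d) := matricization A k + dA k in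
  let P (k : 'I_d) : 'M[R]_(n k) :=
    matricization A k *m X k *m eps_pinv eps ((Y k)^T *m At k *m X k)
      *m (Y k)^T in
  let epsk (k : 'I_d) := tfrob (A - modeprod A (P k)) in
  let tauk (k : 'I_d) := 1 + spectral_norm (P k) in
  let epst := \big[Num.max/0]_(k < d) epsk k in
  let taut := \big[Num.max/0]_(k < d) tauk k in
  tfrob (A - multiprod A P) <= epst / taut * ((1 + taut) ^+ d - 1).
Proof. exact: tfrob_sub_multiprod hd. Qed.
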